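(* Let $G$ be an Abelian group and $\{a_n\}_{n\in\omega}$ a $PT$-sequence in $G$. Then the paratopological group $P(G|\{a_n\}_{n\in\omega})$ is a sequential space.
   Context: A paratopological group topology is a topology making the group operation jointly continuous; all such topologies are assumed $T_1$. A sequence $\{a_n\}_{n\in\omega}$ in $G$ is a $PT$-sequence if there is a ($T_1$) paratopological group topology on $G$ in which $\{a_n\}$ converges to $0$; then $P(G|\{a_n\}_{n\in\omega})$ denotes $G$ endowed with the strongest (finest) such topology. A subset $U$ of a space is sequentially open if every sequence converging to a point of $U$ is eventually in $U$; a space is sequential if every sequentially open subset is open. *)

(* Defs.v *)
From HB Require Import structures.
From mathcomp Require Import all_boot all_order all_algebra finmap.
From mathcomp Require Import all_classical topology.

Set Implicit Arguments.
Unset Strict Implicit.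
Unset Printing Implicit Defensive.

Import GRing.Theory.

Local Open Scope classical_set_scope.
Local Open Scope ring_scope.

Section Sequential.
Variable T : topologicalType.

Definition sequentially_open (U : set T) : Prop :=
  forall (x : nat -> T) (l : T),
    x @ \oo --> l -> U l -> \forall n \near \oo, U (x n).

Definition sequential_space : Prop :=
  forall U : set T, sequentially_open U -> open U.

End Sequential.

Section ParatopologicalGroup.
Variable G : zmodType.

(* Several topologies on the same group G are compared, so a topology is a
   structure t : Topological G and not a canonical instance on G. *)
Definition with_topology (t : Topological G) : topologicalType := Topological.Pack t.

(* The T1 axiom is part of the definition. *)
Definition paratopological_group_topology (t : Topological G) : Prop :=
  accessible_space (with_topology t) /\
  continuous (fun xy : with_topology t * with_topology t => (xy.1 : G) + xy.2 : with_topology t).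

Definition finer (t s : Topological G) : Prop :=
  forall U : set G, open (U : set (with_topology s)) -> open (U : set (with_topology t)).

Variable a : nat -> G.

Definition PT_topology (t : Topological G) : Prop :=
  paratopological_group_topology t /\
  (a : nat -> with_topology t) @ \oo --> ((0 : G) : with_topology t).

Definition PT_sequence : Prop := exists t, PT_topology t.

(* [strongest_PT_topology t] says that [with_topology t] is P(G|a); such a t exists
   for every PT-sequence and its open sets are determined by a, see below. *)
Definition strongest_PT_topology (t : Topological G) : Prop :=
  PT_topology t /\ forall s, PT_topology s -> finer t s.

Lemma strongest_PT_topology_exists :
  PT_sequence -> exists t, strongest_PT_topology t.
Proof.
case=> t0 t0P.
pose Tc (i : {t | PT_topology t}) : Topological G := sval i.
pose S : topologicalType := sup_topology Tc.
have fin i U : open (U : set (with_topology (Tc i))) -> open (U : set S).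
  move=> oU; exists [set U]; last by rewrite bigcup_set1.
  move=> _ ->; exists [fset U]%fset.
    by move=> V; rewrite inE inE => /eqP ->; exists i.
  by rewrite set_fset1 bigcap_set1.
have le i (x : G) : nbhs (x : S) --> (x : with_topology (Tc i)).
  move=> A; rewrite (@nbhsE (with_topology (Tc i))) => -[B [oB Bx] BA].
  rewrite nbhs_filterE (@nbhsE S); exists B => //; split => //.
  exact: (fin i).
exists (Topological.class S); split; last first.
  by move=> s sP U; exact: (fin (exist _ s sP)).
split; last first.
  apply/(@cvg_sup _ _ Tc) => i.
  by case: i => t [tP ta].
split=> [x y xy|].
  case: (t0P) => -[T1 _] _.
  have [A [oA xA yA]] := T1 x y (introN (@eqP (with_topology t0) x y) (elimN eqP xy)).
  by exists A; split => //; exact: (fin (exist _ t0 t0P)).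
move=> [x y]; apply/(@cvg_sup _ _ Tc) => i.
have [[_ addc] _] := svalP i.
apply: (cvg_trans _ (addc (x, y))).
apply: cvg_app => C [[/= A B] [/= Ax By] AB].
by exists (A, B) => //=; split; exact: (le i).
Qed.

Lemma strongest_PT_topology_unique t s :
  strongest_PT_topology t -> strongest_PT_topology s ->
  forall U : set G, open (U : set (with_topology t)) <-> open (U : set (with_topology s)).
Proof. by move=> [tP tm] [sP sm] U; split; [exact: sm|exact: tm]. Qed.

End ParatopologicalGroup.

(* Main.v *)
(** If [n] is a sequence of indices, let [W n] be the set of the finite sums
    e_0 + ... + e_k in which each e_i is 0 or some a_m with m >= n i.  These sets
    are a neighbourhood base at 0 of a group topology in which a converges to 0,
    so a set containing x + W n for each of its points x is open in P(G|a).
    A sequentially open V containing 0 contains some W n: if V is sequentially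
    open then so is [{x in V | x + a_m in V for all m >= N}], so the n i can be
    chosen one after the other, keeping 0 in the shrunken set. *)
Require Import Defs.
From HB Require Import structures.
From mathcomp Require Import all_boot all_order all_algebra.
From mathcomp Require Import all_classical topology.

Set Implicit Arguments.
Unset Strict Implicit.
Unset Printing Implicit Defensive.

Import GRing.Theory.

Local Open Scope classical_set_scope.
Local Open Scope ring_scope.

Section TailSums.
Variables (G : zmodType) (a : nat -> G).

(** The value 0 lets a slot of a sum stay empty, so summands can be moved to later slots. *)
Definition tail (N : nat) : set G :=
  [set e | e = 0 \/ exists2 m, (N <= m)%N & e = a m].

Inductive tail_sums : (nat -> nat) -> G -> Prop :=
| tail_sums_nil n : tail_sums n 0
| tail_sums_cons n e x :
    tail (n 0%N) e -> tail_sums (n \o S) x -> tail_sums n (e + x).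

Definition tail_open : set_system G :=
  [set U | forall x, U x -> exists n, forall y, tail_sums n y -> U (x + y)].

Lemma tail0 N : tail N 0. Proof. by left. Qed.

Lemma sub_tail N M : (N <= M)%N -> tail M `<=` tail N.
Proof.
move=> NM e [->|[m Mm ->]]; first exact: tail0.
by right; exists m => //; exact: leq_trans Mm.
Qed.

Lemma sub_tail_sums n m :
  (forall i, (n i <= m i)%N) -> tail_sums m `<=` tail_sums n.
Proof.
move=> nm x xm; elim: xm n nm => {m x} [m n _|m e x em _ IH n nm].
  exact: tail_sums_nil.
apply: tail_sums_cons (sub_tail (nm 0%N) em) _.
by apply: IH => i; exact: nm.
Qed.

Lemma tail_sumsE n x : tail_sums n x ->
  exists e y, [/\ x = e + y, tail (n 0%N) e & tail_sums (n \o S) y].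
Proof.
case=> {n x} [n|n e x en xn]; last by exists e, x.
by exists 0, 0; split; [rewrite addr0|exact: tail0|exact: tail_sums_nil].
Qed.

Lemma tail_sums_double n m :
  (forall i, (n i.*2 <= m i)%N) -> tail_sums m `<=` tail_sums n.
Proof.
move=> nm x xm; elim: xm n nm => {m x} [m n _|m e x em _ IH n nm].
  exact: tail_sums_nil.
apply: tail_sums_cons (sub_tail (nm 0%N) em) _; rewrite -[x]add0r.
apply: tail_sums_cons (tail0 _) _.
by apply: IH => i; exact: (nm i.+1).
Qed.

(** Interleaving: the i-th summand of [x] takes slot 2i and that of [y] slot 2i + 1; once [x] has
    ended, the rest of [y] is spread over even slots. There are two bounds because [n] may be
    non-monotone. *)
Lemma tail_sumsD n m x y :
    (forall i, (n i.*2 <= m i)%N) -> (forall i, (n i.*2.+1 <= m i)%N) ->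
  tail_sums m x -> tail_sums m y -> tail_sums n (x + y).
Proof.
move=> nm nSm xm; elim: xm n nm nSm y => {m x} [m|m e x em _ IH] n nm nSm y.
  by rewrite add0r; exact: tail_sums_double.
move=> /tail_sumsE[e' [z [-> e'm zm]]]; rewrite addrACA -addrA.
apply: tail_sums_cons (sub_tail (nm 0%N) em) _.
apply: tail_sums_cons (sub_tail (nSm 0%N) e'm) _.
by apply: IH => // i; [exact: (nm i.+1)|exact: (nSm i.+1)].
Qed.

Lemma tail_sums_half n :
  exists m, forall x y, tail_sums m x -> tail_sums m y -> tail_sums n (x + y).
Proof.
exists (fun i => maxn (n i.*2) (n i.*2.+1)) => x y.
by apply: tail_sumsD => i; [exact: leq_maxl|exact: leq_maxr].
Qed.

(** A sum that fills the first k slots of [n] can be continued by any sum for [n] shifted by k. *)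
Lemma tail_sums_open n : tail_open (tail_sums n).
Proof.
move=> x; elim=> {n x} [n|n e x en _ [m IH]].
  by exists n => y; rewrite add0r.
by exists m => y /IH; rewrite -addrA; exact: tail_sums_cons.
Qed.

Lemma tail_open_translate x U :
  tail_open U -> tail_open [set y | U (y - x)].
Proof.
by move=> oU y /oU[n nU]; exists n => z /nU /=; rewrite addrAC.
Qed.

Lemma tail_openT : tail_open setT.
Proof. by move=> x _; exists id. Qed.

Lemma tail_openI : setI_closed tail_open.
Proof.
move=> A B oA oB x [/oA[n nA] /oB[m mB]].
exists (fun i => maxn (n i) (m i)) => y xy; split.
  by apply: nA; apply: sub_tail_sums xy => i; exact: leq_maxl.
by apply: mB; apply: sub_tail_sums xy => i; exact: leq_maxr.
Qed.

Lemma tail_open_bigU (I : Type) (f : I -> set G) :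
  (forall i, tail_open (f i)) -> tail_open (\bigcup_i f i).
Proof. by move=> of_ x [i _ /of_[n nf]]; exists n => y /nf; exists i. Qed.

Definition tail_space : Type := G.
HB.instance Definition _ := Choice.on tail_space.
HB.instance Definition _ := isOpenTopological.Build tail_space
  tail_openT tail_openI tail_open_bigU.

Definition tail_topology : Topological G := Topological.class tail_space.

Lemma tail_nbhsP (x : G) (A : set G) :
  nbhs (x : with_topology tail_topology) A <->
  exists n, forall y, tail_sums n y -> A (x + y).
Proof.
split=> [[B [oB Bx BA]]|[n nA]].
  by have [n nB] := oB _ Bx; exists n => y /nB; exact: BA.
(* [tail_sums n] is itself open, so its translate by [x] is an open neighbourhood inside [A]. *)
exists [set y | tail_sums n (y - x)]; split=> /=.
- exact/tail_open_translate/tail_sums_open.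
- by rewrite subrr; exact: tail_sums_nil.
- by move=> y /nA; rewrite addrC subrK.
Qed.

Lemma tail_topology_addr_continuous :
  continuous (fun xy : with_topology tail_topology * with_topology tail_topology =>
    (xy.1 : G) + xy.2 : with_topology tail_topology).
Proof.
move=> [x y] A /tail_nbhsP[n nA]; have [m mn] := tail_sums_half n.
exists ([set z | tail_sums m (z - x)], [set z | tail_sums m (z - y)]) => /=.
  by split; apply/tail_nbhsP; exists m => z; rewrite /= addrC addKr.
move=> [u v] [/= um vm]; have := nA _ (mn _ _ um vm).
by rewrite -addrACA [x + _]addrC [y + _]addrC !subrK.
Qed.

Lemma tail_topology_cvg :
  (a : nat -> with_topology tail_topology) @ \oo -->
  ((0 : G) : with_topology tail_topology).
Proof.
move=> A /tail_nbhsP[n nA]; exists (n 0%N) => // m /= nm.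
have := nA (a m); rewrite add0r; apply.
rewrite -[a m]addr0; apply: tail_sums_cons (tail_sums_nil _).
by right; exists m.
Qed.

Section SequentiallyOpen.
Variable P : Topological G.
Hypothesis PT_P : PT_topology a P.

Lemma PT_cvgD (x y : nat -> with_topology P) (l k : with_topology P) :
    x @ \oo --> l -> y @ \oo --> k ->
  (fun i => (x i : G) + y i : with_topology P) @ \oo -->
  ((l : G) + k : with_topology P).
Proof.
move=> xl yk; have [[_ addc] _] := PT_P.
exact: (cvg_comp _ _ (cvg_pair xl yk) (addc (l, k))).
Qed.

Lemma sequentially_open_translate x (V : set (with_topology P)) :
  sequentially_open V ->
  sequentially_open ([set y | V (x + y)] : set (with_topology P)).
Proof. by move=> oV u l ul; apply: oV; apply: PT_cvgD => //; exact: cvg_cst. Qed.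

(** For [i] and [j] both large, [x i + a j] is in [V]: otherwise such sums outside [V] would form a
    sequence converging to [l + 0], a point of [V]. For each of the finitely many remaining
    [j >= N], [x i + a j] converges to [l + a j], again a point of [V]. *)
Lemma sequentially_open_tail N (V : set (with_topology P)) :
  sequentially_open V ->
  sequentially_open
    ([set x | forall e : G, tail N e -> V ((x : G) + e)] : set (with_topology P)).
Proof.
move=> oV x l xl Vl; have [_ a0] := PT_P.
have Vfix (e : G) : tail N e -> \forall i \near \oo, V ((x i : G) + e).
  move=> eN; apply: (oV _ _ _ (Vl _ eN)).
  by apply: PT_cvgD => //; exact: cvg_cst.
have Vfin K : \forall i \near \oo,
    forall j, (j < K)%N -> (N <= j)%N -> V ((x i : G) + a j).
  elim: K => [|K IH]; first by near=> i.
  have VK : \forall i \near \oo, (N <= K)%N -> V ((x i : G) + a K).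
    have [NK|/negP NK] := boolP (N <= K)%N; last by near=> i.
    have /Vfix : tail N (a K) by right; exists K.
    by apply: filterS => i ? _.
  apply: filterS2 VK IH => i VKi IHi j.
  by rewrite ltnS leq_eqVlt => /predU1P[->|/IHi].
have [K VK] : exists K, forall i j, (K <= i)%N -> (K <= j)%N -> V ((x i : G) + a j).
  apply: contrapT => noK.
  have bad K : exists ij : nat * nat,
      [/\ (K <= ij.1)%N, (K <= ij.2)%N & ~ V ((x ij.1 : G) + a ij.2)].
    apply: contrapT => noij; apply: noK; exists K => i j Ki Kj.
    by apply: contrapT => nV; apply: noij; exists (i, j).
  (* The chosen indices need not increase; both tend to infinity, which is enough for
     convergence. *)
  have [f fP] := choice bad.
  have f1 : (fun K => (f K).1) @ \oo --> \oo.
    by apply/cvgnyPge => K; exists K => // k /= Kk; have [/(leq_trans Kk)] := fP k.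
  have f2 : (fun K => (f K).2) @ \oo --> \oo.
    by apply/cvgnyPge => K; exists K => // k /= Kk; have [_ /(leq_trans Kk)] := fP k.
  have := PT_cvgD (cvg_comp _ _ f1 xl) (cvg_comp _ _ f2 a0).
  move=> /oV /(_ (Vl _ (tail0 _)))[M _ /(_ M (leqnn M))] /=.
  by have [] := fP M.
near=> i; move=> e [->|[j Nj ->]]; first by near: i; apply: Vfix; exact: tail0.
have [jK|Kj] := ltnP j K; last by apply: VK => //; near: i; exact: nbhs_infty_ge.
by move: j jK Nj; near: i; exact: Vfin.
Unshelve. all: by end_near. Qed.

Lemma sequentially_open_tail_sums (V : set (with_topology P)) :
  sequentially_open V -> V (0 : G) -> exists n, tail_sums n `<=` V.
Proof.
have [_ a0] := PT_P.
(* Each index depends on the set shrunk so far. Bundling sets with their properties lets [choice]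
   give a map [next] that can be iterated from [V]. *)
pose good := {V : set (with_topology P) | sequentially_open V /\ V (0 : G)}.
have step (U : good) : exists NW : nat * good,
    forall x e : G, sval NW.2 x -> tail NW.1 e -> sval U (x + e).
  (* As [a] converges to 0, a point of [U], some tail of [a] lies in [U]; this keeps 0 in the
     shrunken set. *)
  case: U => U [oU U0]; have [N _ NU] := oU _ _ a0 U0.
  have NU0 (e : G) : tail N e -> U ((0 : G) + e).
    by rewrite add0r => -[->//|[m Nm ->]]; exact: NU.
  have [W WE] : exists W : good,
      sval W = [set x : G | forall e : G, tail N e -> U (x + e)].
    unshelve eexists (exist _ _ _); last reflexivity.
    by split => //; exact: sequentially_open_tail.
  by exists (N, W) => x e /=; rewrite WE; apply.
have [next nextP] := choice step.
move=> oV V0; pose U i := iter i (fun U => (next U).2) (exist _ V (conj oV V0) : good).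
exists (fun i => (next (U i)).1).
(* Generalised over the stage [i]: without its first summand the sum lies in [U i.+1] by induction,
   and [nextP] adds that summand back to land in [U i]. *)
suff sub n x : tail_sums n x ->
    forall i, (forall k, n k = (next (U (i + k)%N)).1) -> sval (U i) x.
  by move=> x /sub /(_ 0%N); apply.
elim=> {n x} [n i _|n e x en _ IH i nU]; first by have [] := svalP (U i).
rewrite addrC; apply: nextP; last by rewrite -[i]addn0 -nU.
by apply: (IH i.+1) => k; rewrite addSnnS; exact: nU.
Qed.

Lemma sequentially_open_tail_open (V : set (with_topology P)) :
  sequentially_open V -> tail_open V.
Proof.
move=> oV x Vx; have [|n nV] :=
  sequentially_open_tail_sums (sequentially_open_translate (x := x) oV).
  by rewrite /= addr0.
by exists n => y /nV.
Qed.

Lemma open_tail_open (V : set (with_topology P)) : open V -> tail_open V.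
Proof.
move=> oV; apply: sequentially_open_tail_open => x l xl Vl.
exact/xl/open_nbhs_nbhs.
Qed.

(** Sets open in [P] are tail-open, so [tail_topology] is finer than [P] and inherits T1 from it. *)
Lemma PT_topology_tail : PT_topology a tail_topology.
Proof.
have [[T1 _] _] := PT_P.
split; last exact: tail_topology_cvg.
split; last exact: tail_topology_addr_continuous.
move=> x y xy.
have [A [oA xA yA]] :=
  T1 x y (introN (@eqP (with_topology P) x y) (elimN eqP xy)).
by exists A; split => //; exact: open_tail_open.
Qed.

End SequentiallyOpen.
End TailSums.

Theorem theorem5p14 (G : zmodType) (a : nat -> G) (P : Topological G) :
  PT_sequence a -> strongest_PT_topology a P -> sequential_space (with_topology P).
Proof.
move=> _ [PT_P finest] V oV.
apply: (finest _ (PT_topology_tail PT_P)).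
exact: sequentially_open_tail_open oV.
Qed.
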